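(* Let $\beta>0$, let $\mathsf{ALG}$ be a $\beta$-nice algorithm with output size $k'=k$, let $\{T_1,\dots,T_m\}$ be a random clustering of $\mathbb N$ with multiplicity $1$ (each item independently placed in one uniformly random part), and let $S_i=\mathsf{ALG}(T_i)$ for $1\le i\le m$. Let $\mathrm{OPT}\in\arg\max_{|S|\le k}f(S)$. (i) If $f$ is non-negative monotone submodular and $S=\mathsf{Greedy}(\bigcup_{i=1}^m S_i)$ (greedy run for $k$ iterations on the ground set $\bigcup_i S_i$), then $\mathbb E[\max\{f(S),\max_{1\le i\le m}f(S_i)\}]\ge\frac{(1-1/e)f(\mathrm{OPT})}{1+(1-1/e)(1+\beta)}$. (ii) If $f$ is non-negative (possibly non-monotone) submodular and $S$ is the output of the non-monotone submodular maximization algorithm of Buchbinder, Feldman, Naor and Schwartz (SODA 2014) run on $\bigcup_{i=1}^m S_i$ with cardinality constraint $k$, then $\mathbb E[\max\{f(S),\max_{1\le i\le m}f(S_i)\}]\ge\frac{(1-\frac1m)f(\mathrm{OPT})/e}{1+(1+\beta)/e}$. In particular, for $\beta=1$ these distributed approximation factors are at least $0.27$ (monotone) and at least $0.21-\frac{1}{4m}$ (non-monotone).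
   Context: $\mathbb N$ is a finite ground set, $f:2^{\mathbb N}\to\mathbb R_{\ge0}$; monotone means $f(X)\le f(Y)$ for $X\subseteq Y$; submodular means $f(X\cup\{x\})-f(X)\ge f(Y\cup\{x\})-f(Y)$ for $X\subseteq Y$, $x\notin Y$. $\Delta(x,X)=f(X\cup\{x\})-f(X)$. $\mathsf{Greedy}$ on a ground set $U$ starts with $S=\emptyset$ and, $k$ times, adds an item $x\in U$ maximizing $\Delta(x,S)$. An algorithm $\mathsf{ALG}$ returning $\mathsf{ALG}(T)\subseteq T$ with $|\mathsf{ALG}(T)|\le k'$ is $\beta$-nice for $f$ if for every $T\subseteq\mathbb N$ and every $x\in T\setminus\mathsf{ALG}(T)$: (a) $\mathsf{ALG}(T\setminus\{x\})=\mathsf{ALG}(T)$, and (b) $\Delta(x,\mathsf{ALG}(T))\le\beta f(\mathsf{ALG}(T))/k'$. The Buchbinder et al. algorithm is a (randomized) algorithm for maximizing a non-negative submodular function under a cardinality constraint $k$ on a ground set $U$ returning a set of size at most $k$ whose expected value is at least $\frac1e\max_{S'\subseteq U,|S'|\le k}f(S')$. *)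

(* Defs.v *)
From mathcomp Require Import all_boot all_order all_algebra.
From mathcomp Require Import reals.
From mathcomp.analysis Require Import sequences exp.

Set Implicit Arguments.
Unset Strict Implicit.
Unset Printing Implicit Defensive.

Import Order.TTheory GRing.Theory Num.Theory.
Local Open Scope ring_scope.

Definition monotone (R : realType) (T : finType) (f : {set T} -> R) : Prop :=
  forall X Y : {set T}, X \subset Y -> f X <= f Y.

Definition submodular (R : realType) (T : finType) (f : {set T} -> R) : Prop :=
  forall (X Y : {set T}) (x : T), X \subset Y -> x \notin Y ->
    f (x |: Y) - f Y <= f (x |: X) - f X.

Definition marginal (R : realType) (T : finType) (f : {set T} -> R)
    (x : T) (X : {set T}) : R := f (x |: X) - f X.

(* [greedy_output f U n S]: S is a possible result of n greedy iterations on
   the ground set U, under some way of breaking ties.  On an empty ground set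
   there is nothing to add and the iteration leaves S unchanged, so an output
   exists for all U and n. *)
Inductive greedy_output (R : realType) (T : finType) (f : {set T} -> R)
    (U : {set T}) : nat -> {set T} -> Prop :=
| Greedy_init : greedy_output f U 0 set0
| Greedy_add (n : nat) (S : {set T}) (x : T) :
    greedy_output f U n S -> x \in U ->
    (forall y, y \in U -> marginal f y S <= marginal f x S) ->
    greedy_output f U n.+1 (x |: S)
| Greedy_void (n : nat) (S : {set T}) :
    greedy_output f U n S -> U = set0 -> greedy_output f U n.+1 S.

Record nice (R : realType) (T : finType) (f : {set T} -> R) (k' : nat)
    (beta : R) (ALG : {set T} -> {set T}) : Prop := Nice {
  nice_sub : forall A : {set T}, ALG A \subset A;
  nice_card : forall A : {set T}, (#|ALG A| <= k')%N;
  nice_remove : forall (A : {set T}) (x : T), x \in A :\: ALG A ->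
    ALG (A :\ x) = ALG A;
  nice_marginal : forall (A : {set T}) (x : T), x \in A :\: ALG A ->
    marginal f x (ALG A) <= beta * f (ALG A) / k'%:R }.

(* A probability distribution on a finite type is given by its weights. *)
Definition is_distr (R : realType) (A : finType) (p : A -> R) : Prop :=
  (forall a, 0 <= p a) /\ \sum_(a : A) p a = 1.

Definition expectation (R : realType) (A : finType) (p : A -> R) (X : A -> R)
  : R := \sum_(a : A) p a * X a.

(* A clustering into m parts is the map sending each item to the index of its
   part. *)
Definition part (T : finType) (m : nat) (c : {ffun T -> 'I_m}) (i : 'I_m)
  : {set T} := [set x | c x == i].

(* Items are placed independently, hence the product over the items; each
   factor is the probability 1/m that x is placed in part c x. *)
Definition random_clustering (R : realType) (T : finType) (m : nat)
    (c : {ffun T -> 'I_m}) : R := \prod_(x : T) m%:R^-1.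

Definition union_core (T : finType) (m : nat) (ALG : {set T} -> {set T})
    (c : {ffun T -> 'I_m}) : {set T} := \bigcup_(i < m) ALG (part c i).

(* max {f S, max_i f (S_i)} where S_i = ALG (T_i); the iterated maximum starts
   from f S. *)
Definition best_value (R : realType) (T : finType) (m : nat)
    (f : {set T} -> R) (ALG : {set T} -> {set T}) (c : {ffun T -> 'I_m})
    (S : {set T}) : R :=
  \big[Num.max/f S]_(i < m) f (ALG (part c i)).

Definition euler (R : realType) : R := expR 1.

(* The guarantee of the Buchbinder-Feldman-Naor-Schwartz algorithm.  For each
   ground set U, [A U] is the law of the random output of the algorithm with
   value oracle f and cardinality constraint k on U. *)
Record BFNS_algorithm (R : realType) (T : finType) (f : {set T} -> R)
    (k : nat) (A : {set T} -> {set T} -> R) : Prop := BFNSAlgorithm {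
  BFNS_distr : forall U : {set T}, is_distr (A U);
  BFNS_feasible : forall U S : {set T}, A U S != 0 ->
    S \subset U /\ (#|S| <= k)%N;
  BFNS_value : forall U S' : {set T}, S' \subset U -> (#|S'| <= k)%N ->
    1 / euler R * f S' <= expectation (A U) f }.

(* Main.v *)
(* Let S_i = ALG(T_i), let N_i be the set of items of OPT that ALG rejects when
   they are added to T_i, and let P be the union of the S_i intersected with
   OPT.  Niceness gives f(S_i u N_i) <= (1 + beta) f(S_i).  Let w be a vertex
   of the base polytope of f restricted to OPT, so that w(X) <= f(X) - f(0) for
   X included in OPT, with equality at OPT; since OPT is optimal, w >= 0, and
   submodularity gives f(OPT u S_i) <= f(S_i u N_i) + w(OPT \ N_i).  An item x
   is accepted after being added to the part of a uniformly random index i with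
   the same probability as it is selected in its own part, because moving x to
   part i does not change the law of the clustering; hence the average over i
   of E w(OPT \ N_i) is E w(P), which is at most E f(P).  Finally f(P) is
   approximated by the second round, and the average over i of f(OPT u S_i) is
   at least f(OPT) if f is monotone, and at least (1 - 1/m) f(OPT) in general
   because the S_i are disjoint. *)
Require Import Defs.
From mathcomp Require Import all_boot all_order all_algebra.
From mathcomp Require Import ring lra reals.
From mathcomp.analysis Require Import sequences exp.

Set Implicit Arguments.
Unset Strict Implicit.
Unset Printing Implicit Defensive.

Import Order.TTheory GRing.Theory Num.Theory.
Local Open Scope ring_scope.

Lemma set_ind_add (T : finType) (P : {set T} -> Prop) :
  P set0 -> (forall (x : T) (A : {set T}), x \notin A -> P A -> P (x |: A)) -> forall A, P A.
Proof.
move=> P0 PS A; elim: {A}#|A| {-2}A (erefl #|A|) => [A /eqP|n IHn A cA].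
  by rewrite cards_eq0 => /eqP ->.
have /card_gt0P[x xA] : (0 < #|A|)%N by rewrite cA.
rewrite -(setD1K xA); apply: PS; first by rewrite setD11.
by apply: IHn; move: cA; rewrite (cardsD1 x) xA => -[].
Qed.

(** * Submodular functions, with no sign or monotonicity assumption *)

Section Submodular.
Variables (R : realType) (T : finType) (f : {set T} -> R).
Hypothesis f_submodular : submodular f.

Lemma submodularU (X Y Z : {set T}) : X \subset Y -> [disjoint Z & Y] ->
  f (Y :|: Z) - f Y <= f (X :|: Z) - f X.
Proof.
move=> sXY; elim/set_ind_add: Z => [_|x Z xZ IH]; first by rewrite !setU0; lra.
rewrite disjoints_subset subUset sub1set inE -disjoints_subset => /andP[xY dZ].
have := @f_submodular (X :|: Z) (Y :|: Z) x (setSU _ sXY).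
rewrite inE (negPf xY) (negPf xZ) => /(_ isT).
rewrite ![_ :|: (x |: Z)]setUCA; have := IH dZ; lra.
Qed.

Lemma submodularUI (A B : {set T}) : f (A :|: B) + f (A :&: B) <= f A + f B.
Proof.
have dBA : [disjoint B :\: A & A] by rewrite -setI_eq0 setIDAC setDIl setDv setI0.
have := submodularU (subsetIl A B) dBA.
have -> : A :|: B :\: A = A :|: B by rewrite setDE setUIr setUCr setIT.
have -> : A :&: B :|: B :\: A = B by rewrite setIC setID.
lra.
Qed.

Lemma submodular_sum_marginal (S Z : {set T}) :
  f (S :|: Z) <= f S + \sum_(z in Z) marginal f z S.
Proof.
elim/set_ind_add: Z => [|x Z xZ IH]; first by rewrite big_set0 setU0 addr0.
rewrite big_setU1 //= setUCA.
have [xS|xS] := boolP (x \in S).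
  have -> : marginal f x S = 0.
    by rewrite /marginal (setUidPr _) ?sub1set // subrr.
  by rewrite add0r (setUidPr _) // sub1set inE xS.
have := @f_submodular S (S :|: Z) x (subsetUl _ _).
rewrite inE (negPf xS) (negPf xZ) => /(_ isT).
rewrite {1}/marginal; lra.
Qed.

(** Edmonds' greedy vertex: [O] is built item by item and each item is weighted by its marginal over
    the earlier ones. If [X] contains the last item [a], then [a] gains at least as much over
    [X :\ a] as over [O]. *)
Lemma submodular_base (O : {set T}) : exists w : T -> R,
  f set0 + \sum_(x in O) w x = f O /\
  forall X : {set T}, X \subset O -> f set0 + \sum_(x in X) w x <= f X.
Proof.
elim/set_ind_add: O => [|a O aO [w [wO wX]]].
  exists (fun=> 0); rewrite big_set0 addr0; split=> // X.
  by rewrite subset0 => /eqP ->; rewrite big_set0 addr0.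
pose w' x := if x == a then f (a |: O) - f O else w x.
have w'E (X : {set T}) : a \notin X -> \sum_(x in X) w' x = \sum_(x in X) w x.
  move=> aX; apply: eq_bigr => x xX; rewrite /w'.
  by case: eqP xX aX => // -> ->.
exists w'; split.
  by rewrite big_setU1 //= w'E // {1}/w' eqxx -wO; ring.
move=> X sX; have [aX|aX] := boolP (a \in X); last first.
  rewrite w'E //; apply: wX; apply/subsetP => x xX.
  by move/subsetP/(_ x xX): sX; rewrite !inE; case: eqP xX aX => // -> ->.
have sX' : X :\ a \subset O by rewrite subDset.
rewrite (big_setD1 a) //= w'E ?setD11 // {1}/w' eqxx.
have := f_submodular sX' aO; rewrite setD1K //.
have := wX _ sX'; lra.
Qed.

(** By disjointness, [O :|: S a] meets the union built so far together with [O] in exactly [O], so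
    each use of [submodularUI] releases one [f O]. *)
Lemma submodular_disjointU (I : finType) (O : {set T}) (S : I -> {set T})
    (J : {set I}) :
  (forall i j, i != j -> [disjoint S i & S j]) ->
  f (O :|: \bigcup_(i in J) S i) + #|J|%:R * f O
    <= \sum_(i in J) f (O :|: S i) + f O.
Proof.
move=> dS; elim/set_ind_add: J => [|a J aJ IH].
  by rewrite !big_set0 cards0 setU0 mul0r addr0 add0r.
rewrite !big_setU1 //= cardsU1 aJ natrD mulrDl mul1r.
have := submodularUI (O :|: S a) (O :|: \bigcup_(i in J) S i).
have -> : (O :|: S a) :&: (O :|: \bigcup_(i in J) S i) = O.
  rewrite -setUIr; apply/setUidPl; rewrite big_distrr /=.
  apply/bigcupsP => i iJ; rewrite (disjoint_setI0 (dS _ _ _)) ?sub0set //.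
  by apply: contraNneq aJ => ->.
rewrite setUACA setUid.
move: IH; lra.
Qed.

End Submodular.

(** * The greedy guarantee for monotone functions *)

Section Greedy.
Variables (R : realType) (T : finType) (f : {set T} -> R).
Hypotheses (f_ge0 : forall X, 0 <= f X) (f_submodular : submodular f).
Hypothesis f_monotone : monotone f.

(** The best item gains at least the average marginal over [S'], hence at least a fraction [1/k] of
    the gap to [f S']; each iteration thus shrinks the gap by the factor [1 - 1/k]. *)
Lemma greedy_gap (U S S' : {set T}) (k n : nat) :
  greedy_output f U n S -> S' \subset U -> (#|S'| <= k)%N -> (0 < k)%N ->
  f S' - f S <= (1 - k%:R^-1) ^+ n * f S'.
Proof.
move=> GS sS'U cS' k0.
have k0R : 0 < k%:R :> R by rewrite ltr0n.
have q0 : 0 <= 1 - k%:R^-1 :> R.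
  by rewrite subr_ge0 invf_le1 // ler1n.
elim: GS => [|{S}n S x _ IH xU xmax|{S}n S _ _ U0].
- by rewrite expr0 mul1r; have := f_ge0 set0; lra.
- have step : f S' - f S <= k%:R * marginal f x S.
    have := submodular_sum_marginal f_submodular S S'.
    have := f_monotone (subsetUr S S').
    have : \sum_(z in S') marginal f z S <= k%:R * marginal f x S.
      apply: (le_trans (y := \sum_(z in S') marginal f x S)).
        by apply: ler_sum => z /(subsetP sS'U); apply: xmax.
      rewrite sumr_const -[leLHS]mulr_natl ler_wpM2r ?ler_nat //.
      by rewrite subr_ge0 f_monotone ?subsetUr.
    lra.
  have : (f S' - f S) / k%:R <= marginal f x S.
    by rewrite ler_pdivrMr // mulrC.
  have := ler_wpM2l q0 IH.
  rewrite exprS -mulrA /marginal; move: (f (x |: S)) => a.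
  move: ((1 - k%:R^-1) ^+ n * f S') => b; nra.
- have -> : S' = set0 by apply/eqP; rewrite -subset0 -U0.
  apply: (le_trans (y := 0)); first by rewrite subr_le0 f_monotone ?sub0set.
  by rewrite mulr_ge0 ?exprn_ge0.
Qed.

Lemma greedy_approx (U S S' : {set T}) (k : nat) :
  greedy_output f U k S -> S' \subset U -> (#|S'| <= k)%N ->
  (1 - 1 / euler R) * f S' <= f S.
Proof.
move=> GS sS'U cS'; have e0 : 0 < 1 / euler R by rewrite divr_gt0 ?expR_gt0.
have [k0|k0] := posnP k.
  move: cS'; rewrite k0 leqn0 cards_eq0 => /eqP ->.
  have := f_monotone (sub0set S); have := f_ge0 set0.
  nra.
have := greedy_gap GS sS'U cS' k0.
have : (1 - k%:R^-1) ^+ k <= 1 / euler R.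
  apply: (le_trans (y := expR (- k%:R^-1) ^+ k)).
    rewrite lerXn2r ?nnegrE ?expR_ge0 //.
      by rewrite subr_ge0 invf_le1 ?ler1n // ltr0n.
    exact: expR_ge1Dx.
  rewrite -expRM_natl mulrN mulfV ?pnatr_eq0 -?lt0n //.
  by rewrite expRN div1r.
move/(ler_wpM2r (f_ge0 S')); lra.
Qed.

End Greedy.

(** * Finite expectations *)

Section Expectation.
Variables (R : realType) (A : finType) (p : A -> R).

Lemma expectation_le (X Y : A -> R) :
  is_distr p -> (forall a, p a != 0 -> X a <= Y a) ->
  expectation p X <= expectation p Y.
Proof.
move=> [p0 _] XY; apply: ler_sum => a _.
have [->|pa] := eqVneq (p a) 0; first by rewrite !mul0r.
by rewrite ler_wpM2l ?XY.
Qed.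

Lemma expectation_cst (x : R) :
  is_distr p -> expectation p (fun=> x) = x.
Proof. by move=> [_ p1]; rewrite /expectation -mulr_suml p1 mul1r. Qed.

Lemma expectationD (X Y : A -> R) :
  expectation p (fun a => X a + Y a) = expectation p X + expectation p Y.
Proof. by rewrite -big_split; apply: eq_bigr => a _; rewrite mulrDr. Qed.

Lemma expectationZ (x : R) (X : A -> R) :
  expectation p (fun a => x * X a) = x * expectation p X.
Proof. by rewrite mulr_sumr; apply: eq_bigr => a _; rewrite mulrCA. Qed.

Lemma expectation_sum (I : finType) (P : pred I) (X : I -> A -> R) :
  expectation p (fun a => \sum_(i | P i) X i a)
    = \sum_(i | P i) expectation p (X i).
Proof.
by rewrite exchange_big; apply: eq_bigr => a _; rewrite mulr_sumr.
Qed.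

End Expectation.

(** * The uniform law on clusterings and its invariance under moving one item *)

Section RandomClustering.
Variables (R : realType) (T : finType) (m : nat).
Hypothesis m_gt0 : (0 < m)%N.
Local Notation clustering := {ffun T -> 'I_m}.
Local Notation E := (expectation (@random_clustering R T m)).

Lemma random_clustering_distr : is_distr (@random_clustering R T m).
Proof.
split=> [c|]; first by apply: prodr_ge0 => x _; rewrite invr_ge0 ler0n.
rewrite /random_clustering prodr_const sumr_const card_ffun card_ord.
rewrite -[LHS]mulr_natl natrX -exprMn mulfV ?expr1n //.
by rewrite pnatr_eq0 -lt0n.
Qed.

Definition reassign (x : T) (i : 'I_m) (c : clustering) : clustering :=
  [ffun y => if y == x then i else c y].

(* The pairs (c, i) are permuted by the involution exchanging i and c x. *)
Lemma expectation_reassign (x : T) (X : clustering -> R) :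
  \sum_(i < m) E (fun c => X (reassign x i c)) = m%:R * E X.
Proof.
pose sw (u : clustering * 'I_m) := (reassign x u.2 u.1, u.1 x).
have swK : involutive sw.
  move=> [c i]; rewrite /sw /= ffunE eqxx; congr (_, _).
  by apply/ffunP => y; rewrite !ffunE; case: eqP => // ->.
rewrite exchange_big /=.
rewrite (pair_big predT predT
  (fun c i => random_clustering R c * X (reassign x i c))) /=.
rewrite (reindex_inj (inv_inj swK)) /=.
transitivity (\sum_(u : clustering * 'I_m) random_clustering R u.1 * X u.1).
  (* All clusterings have the same weight by conversion, so only the argument of [X] remains, and
     applying the exchange twice restores [c]. *)
  apply: eq_bigr => -[c i] _; congr (_ * X _).
  exact: (congr1 fst (swK (c, i))).
rewrite -(pair_big predT predT (fun c _ => random_clustering R c * X c)) /=.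
by rewrite mulr_sumr; apply: eq_bigr => c _; rewrite sumr_const card_ord mulr_natl.
Qed.

Lemma part_reassign (x : T) (i : 'I_m) (c : clustering) :
  part (reassign x i c) i = x |: part c i.
Proof. by apply/setP => y; rewrite !inE ffunE; case: (y == x) => //=; rewrite eqxx. Qed.

End RandomClustering.

(** * The first round: a nice algorithm on each part of a random clustering *)

Section Core.
Variables (R : realType) (T : finType) (f : {set T} -> R) (k m : nat).
Variables (beta : R) (ALG : {set T} -> {set T}).
Hypotheses (m_gt0 : (0 < m)%N) (beta_gt0 : 0 < beta).
Hypotheses (f_ge0 : forall X, 0 <= f X) (f_submodular : submodular f).
Hypothesis ALG_nice : nice f k beta ALG.
Local Notation E := (expectation (@random_clustering R T m)).

Lemma mem_union_core (c : {ffun T -> 'I_m}) x :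
  (x \in union_core ALG c) = (x \in ALG (part c (c x))).
Proof.
apply/bigcupP/idP => [[i _ xi]|xc]; last by exists (c x).
by have := subsetP (nice_sub ALG_nice _) x xi; rewrite inE => /eqP ->.
Qed.

Lemma nice_setU1 (A : {set T}) x : x \notin ALG (x |: A) ->
  ALG (x |: A) = ALG A.
Proof.
move=> xA; have [xinA|xninA] := boolP (x \in A).
  by rewrite (setUidPr _) ?sub1set.
by rewrite -(nice_remove ALG_nice (A := x |: A) (x := x)) ?setU1K // !inE xA eqxx.
Qed.

(** Adding a rejected item leaves the output [ALG A] unchanged, so its marginal there is at most
    [beta * f (ALG A) / k], and [N] has at most [k] items. *)
Lemma nice_rejected (A N : {set T}) : (#|N| <= k)%N ->
  (forall x, x \in N -> x \notin ALG (x |: A)) ->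
  f (ALG A :|: N) <= (1 + beta) * f (ALG A).
Proof.
move=> cN rN; apply: (le_trans (submodular_sum_marginal f_submodular _ _)).
rewrite mulrDl mul1r lerD2l.
have b0 : 0 <= beta * f (ALG A) by rewrite mulr_ge0 // ltW.
have [k0|k0] := posnP k.
  move: cN; rewrite k0 leqn0 cards_eq0 => /eqP ->.
  by rewrite big_set0.
apply: (le_trans (y := \sum_(z in N) beta * f (ALG A) / k%:R)).
  apply: ler_sum => z /rN zN; rewrite -(nice_setU1 zN).
  by apply: (nice_marginal ALG_nice); rewrite !inE zN eqxx.
rewrite sumr_const -[leLHS]mulr_natr -mulrA ler_piMr //.
by rewrite mulrC ler_pdivrMr ?ltr0n // mul1r ler_nat.
Qed.

Section Optimum.
Variable OPT : {set T}.
Hypothesis OPT_card : (#|OPT| <= k)%N.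
Hypothesis OPT_max : forall X : {set T}, (#|X| <= k)%N -> f X <= f OPT.

(* The weights are nonnegative because dropping an item from OPT does not
   increase its value. *)
Lemma optimum_base : exists w : T -> R,
  [/\ forall x, x \in OPT -> 0 <= w x,
      forall X : {set T}, X \subset OPT -> \sum_(x in X) w x <= f X
    & forall X : {set T}, X \subset OPT ->
        f OPT - f X <= \sum_(x in OPT :\: X) w x].
Proof.
have [w [wO wX]] := submodular_base f_submodular OPT.
exists w; split=> [x xO|X sX|X sX].
- have := wX _ (subD1set OPT x).
  have : f (OPT :\ x) <= f OPT.
    by apply/OPT_max/(leq_trans _ OPT_card)/subset_leq_card/subD1set.
  move: wO; rewrite (big_setD1 x) //=; lra.
- by have := wX _ sX; have := f_ge0 set0; lra.
- have := wX _ sX; move: wO; rewrite (big_setID X) /= (setIidPr sX); lra.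
Qed.

(** [V] stays abstract so that it can be the best value itself or its expectation over a randomized
    second round. *)
Lemma core_average (V : {ffun T -> 'I_m} -> R) :
  (forall c i, f (ALG (part c i)) <= V c) ->
  \sum_(i < m) E (fun c => f (OPT :|: ALG (part c i)))
    <= m%:R * ((1 + beta) * E V + E (fun c => f (OPT :&: union_core ALG c))).
Proof.
move=> fV; have [w [w0 wX wOX]] := optimum_base.
have distr := random_clustering_distr R T m_gt0.
(* Evaluated at [reassign x i c], this indicator tells whether [x] is accepted when added to part
   [i]. *)
pose sel x (c : {ffun T -> 'I_m}) : R := (x \in ALG (part c (c x)))%:R.
have bound i c : f (OPT :|: ALG (part c i))
    <= (1 + beta) * V c + \sum_(x in OPT) w x * sel x (reassign x i c).
  set A := part c i; pose N := [set x in OPT | x \notin ALG (x |: A)].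
  have sN : N \subset OPT by apply/subsetP => x; rewrite inE => /andP[].
  have fN : f (ALG A :|: N) <= (1 + beta) * V c.
    apply: (le_trans (nice_rejected _ _)).
    - exact: leq_trans (subset_leq_card sN) OPT_card.
    - by move=> x; rewrite inE => /andP[].
    - by rewrite ler_wpM2l ?fV // addr_ge0 // ltW.
  (* The union is [OPT :|: ALG A] because [N] lies in [OPT]; the value lost by intersecting with
     [OPT] is paid by the weights of items outside [N], which are all accepted. *)
  have := submodularUI f_submodular OPT (ALG A :|: N).
  have -> : OPT :|: (ALG A :|: N) = OPT :|: ALG A.
    by rewrite setUCA (setUidPl sN) setUC.
  have := wOX _ (subsetIl OPT (ALG A :|: N)).
  have : \sum_(x in OPT :\: OPT :&: (ALG A :|: N)) w x
      <= \sum_(x in OPT) w x * sel x (reassign x i c).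
    rewrite [leRHS](big_setID (OPT :&: (ALG A :|: N))) /=.
    rewrite -[leLHS]add0r lerD //.
      by apply: sumr_ge0 => x; rewrite !inE => /andP[xO _]; rewrite mulr_ge0 ?w0.
    apply: ler_sum => x; rewrite !inE => /andP[xN xO].
    rewrite /sel ffunE eqxx part_reassign -/A.
    by move: xN; rewrite xO /= negb_or negbK => /andP[_ ->]; rewrite mulr1.
  lra.
apply: (le_trans (y := \sum_(i < m) (\sum_(x in OPT)
    w x * E (fun c => sel x (reassign x i c)) + (1 + beta) * E V))).
  apply: ler_sum => i _.
  apply: (le_trans (expectation_le distr (fun c _ => bound i c))).
  rewrite expectationD expectationZ expectation_sum addrC lerD2r.
  by apply: ler_sum => x _; rewrite expectationZ.
rewrite big_split /= sumr_const card_ord -[_ *+ m]mulr_natl addrC mulrDr lerD2l.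
rewrite exchange_big /=.
(* Averaged over [i], acceptance in part [i] becomes selection of [x] in its own part. *)
under eq_bigr => x _ do rewrite -mulr_sumr expectation_reassign mulrCA -expectationZ.
rewrite -mulr_sumr -expectation_sum ler_wpM2l ?ler0n //.
apply: expectation_le => // c _.
apply: (le_trans _ (wX _ (subsetIl OPT (union_core ALG c)))).
rewrite (big_setID (union_core ALG c)) /= [X in _ + X]big1 ?addr0; last first.
  by move=> x; rewrite inE mem_union_core => /andP[xN _]; rewrite /sel (negPf xN) mulr0.
apply: ler_sum => x; rewrite inE mem_union_core => /andP[xO xc].
by rewrite /sel xc mulr1.
Qed.

(** Here [alpha] is the ratio of the second round and [d] the fraction of [f OPT] that survives, on
    average over [i], the union with [ALG (part c i)]. Scaling [core_average] by [alpha] lets [E V]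
    absorb the term in [OPT :&: union_core ALG c]. *)
Lemma core_approx (V : {ffun T -> 'I_m} -> R) (alpha d : R) :
  0 <= alpha ->
  (forall c i, f (ALG (part c i)) <= V c) ->
  (forall c, alpha * f (OPT :&: union_core ALG c) <= V c) ->
  (forall c, m%:R * (d * f OPT) <= \sum_(i < m) f (OPT :|: ALG (part c i))) ->
  alpha * (d * f OPT) <= (1 + alpha * (1 + beta)) * E V.
Proof.
move=> a0 fV aV dO.
have distr := random_clustering_distr R T m_gt0.
have mR : 0 < m%:R :> R by rewrite ltr0n.
have := core_average fV; rewrite -expectation_sum => avg.
have := le_trans (expectation_le distr (fun c _ => dO c)) avg.
rewrite expectation_cst // ler_pM2l // => /(ler_wpM2l a0).
have := expectation_le distr (fun c _ => aV c).
rewrite expectationZ; lra.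
Qed.

End Optimum.

Lemma sum_union_core (O : {set T}) (c : {ffun T -> 'I_m}) :
  (m%:R - 1) * f O <= \sum_(i < m) f (O :|: ALG (part c i)).
Proof.
have dS i j : i != j -> [disjoint ALG (part c i) & ALG (part c j)].
  move=> ij; apply: (disjointW (nice_sub ALG_nice _) (nice_sub ALG_nice _)).
  rewrite -setI_eq0; apply/eqP/setP => x; rewrite !inE.
  by apply: contraNF ij => /andP[/eqP <- /eqP <-].
have := submodular_disjointU f_submodular O [set: 'I_m] dS.
rewrite cardsT card_ord.
under [X in _ <= X + _]eq_bigl do rewrite inE.
have := f_ge0 (O :|: \bigcup_(i in [set: 'I_m]) ALG (part c i)).
lra.
Qed.

End Core.

(** * Numerical bounds and the two guarantees *)

Lemma best_value_ge (R : realType) (T : finType) (f : {set T} -> R) (m : nat)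
    (ALG : {set T} -> {set T}) (c : {ffun T -> 'I_m}) (S : {set T}) :
  f S <= best_value f ALG c S /\
  forall i, f (ALG (part c i)) <= best_value f ALG c S.
Proof.
split=> [|i]; first exact: bigmax_ge_id.
exact: (le_bigmax _ (fun j => f (ALG (part c j)))).
Qed.

(** Both bounds come from [1 + x <= expR x], at [x = 1/8] raised to the power 8 and at [x = -1/64]
    raised to the power 64. *)
Lemma euler_bounds (R : realType) :
  5%:R / 2%:R <= euler R /\ euler R <= 276%:R / 100%:R.
Proof.
split.
  have -> : euler R = expR 8^-1 ^+ 8.
    by rewrite -expRM_natl mulfV ?pnatr_eq0.
  apply: (le_trans (y := (1 + 8^-1) ^+ 8)); first by lra.
  by rewrite lerXn2r ?nnegrE ?expR_ge0 ?expR_ge1Dx //; lra.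
have -> : euler R = (expR (- 64^-1) ^+ 64)^-1.
  by rewrite -expRM_natl mulrN mulfV ?pnatr_eq0 // expRN invrK.
rewrite invf_ple ?posrE ?exprn_gt0 ?expR_gt0 //; last by lra.
apply: (le_trans (y := (1 - 64^-1) ^+ 64)); first by lra.
by rewrite lerXn2r ?nnegrE ?expR_ge0 ?expR_ge1Dx //; lra.
Qed.

Theorem theorem2 (R : realType) (T : finType) (f : {set T} -> R)
    (k m : nat) (beta : R) (ALG : {set T} -> {set T}) (OPT : {set T})
    (m_gt0 : (0 < m)%N)
    (beta_gt0 : 0 < beta)
    (f_ge0 : forall X : {set T}, 0 <= f X)
    (f_submodular : submodular f)
    (ALG_nice : nice f k beta ALG)
    (OPT_card : (#|OPT| <= k)%N)
    (OPT_max : forall X : {set T}, (#|X| <= k)%N -> f X <= f OPT) :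
  let e := euler R in
  [/\ forall G : {ffun T -> 'I_m} -> {set T},
        monotone f ->
        (forall c, greedy_output f (union_core ALG c) k (G c)) ->
        let E := expectation (@random_clustering R T m)
                   (fun c => best_value f ALG c (G c)) in
        (1 - 1 / e) * f OPT / (1 + (1 - 1 / e) * (1 + beta)) <= E
        /\ (beta = 1 -> 27%:R / 100%:R * f OPT <= E),
      forall A : {set T} -> {set T} -> R,
        BFNS_algorithm f k A ->
        let E := expectation (@random_clustering R T m)
                   (fun c => expectation (A (union_core ALG c))
                               (fun S => best_value f ALG c S)) in
        (1 - 1 / m%:R) * f OPT / e / (1 + (1 + beta) / e) <= E
        /\ (beta = 1 -> (21%:R / 100%:R - 1 / (4 * m)%:R) * f OPT <= E),
      27%:R / 100%:R <= (1 - 1 / e) / (1 + (1 - 1 / e) * (1 + 1))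
    & 21%:R / 100%:R - 1 / (4 * m)%:R
        <= (1 - 1 / m%:R) / e / (1 + (1 + 1) / e)].
Proof.
move=> e; have [e_ge e_le] := euler_bounds R; rewrite -/e in e_ge e_le.
have e0 : 0 < e by lra.
have a0 : 0 < 1 - 1 / e by rewrite subr_gt0 ltr_pdivrMr // mul1r; lra.
have mR : 1 <= m%:R :> R by rewrite ler1n.
have mR0 : 0 < m%:R :> R by rewrite ltr0n.
have num1 : 27%:R / 100%:R <= (1 - 1 / e) / (1 + (1 - 1 / e) * (1 + 1)).
  have : 1 / e <= 1 / (5%:R / 2%:R) by rewrite !div1r lef_pV2 ?posrE //; lra.
  by move=> ?; rewrite ler_pdivlMr; lra.
have num2 : 21%:R / 100%:R - 1 / (4 * m)%:R
    <= (1 - 1 / m%:R) / e / (1 + (1 + 1) / e).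
  have -> : (1 - 1 / m%:R) / e / (1 + (1 + 1) / e) = (1 - 1 / m%:R) / (e + 2).
    by field; rewrite !gt_eqF //; lra.
  have -> : 1 / (4 * m)%:R = (1 / m%:R) / 4 :> R.
    by rewrite natrM; field; rewrite gt_eqF.
  have m0 : 0 <= 1 / m%:R :> R by rewrite divr_ge0 // ler0n.
  have m1 : 1 / m%:R <= 1 :> R by rewrite ler_pdivrMr // mul1r.
  rewrite ler_pdivlMr; last by lra.
  (* Both sides are affine in [t], which lies in [0, 1]. At [t = 0] the claim is
     [0.21 * (e + 2) <= 1], which [e <= 2.76] just gives; at [t = 1] the left side is negative. *)
  move: (1 / m%:R) m0 m1 => t; nra.
split=> // [G f_monotone greedyG E|A bfns E].
- have main : (1 - 1 / e) * f OPT / (1 + (1 - 1 / e) * (1 + beta)) <= E.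
    have d0 : 0 < 1 + (1 - 1 / e) * (1 + beta) by nra.
    (* The inserted factor 1 is [d]: monotonicity loses nothing in the union. *)
    rewrite ler_pdivrMr // [leRHS]mulrC -[f OPT in leLHS]mul1r.
    apply: (core_approx m_gt0 beta_gt0 f_ge0 f_submodular ALG_nice OPT_card OPT_max).
    + exact: ltW.
    + by move=> c i; case: (best_value_ge f ALG c (G c)) => _; apply.
    + move=> c; case: (best_value_ge f ALG c (G c)) => SG _; apply: le_trans SG.
      apply: (greedy_approx f_ge0 f_submodular f_monotone (greedyG c)).
        exact: subsetIr.
      exact: leq_trans (subset_leq_card (subsetIl _ _)) OPT_card.
    + move=> c; rewrite mul1r mulr_natl -[m in _ *+ m]card_ord -sumr_const.
      by apply: ler_sum => i _; apply/f_monotone/subsetUl.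
  split=> // beta1; apply: le_trans main; rewrite beta1 [leRHS]mulrAC.
  exact: ler_wpM2r num1.
- have main : (1 - 1 / m%:R) * f OPT / e / (1 + (1 + beta) / e) <= E.
    have e1 : 0 < 1 / e by rewrite divr_gt0.
    have -> : (1 + beta) / e = 1 / e * (1 + beta) by rewrite mulrC div1r.
    (* Puts the bound in the form of [core_approx] with [alpha = 1 / e] and [d = 1 - 1 / m]. *)
    have -> : (1 - 1 / m%:R) * f OPT / e = 1 / e * ((1 - 1 / m%:R) * f OPT).
      by rewrite mulrC [1 / e]div1r.
    rewrite ler_pdivrMr; last by nra.
    rewrite [leRHS]mulrC.
    apply: (core_approx m_gt0 beta_gt0 f_ge0 f_submodular ALG_nice OPT_card OPT_max).
    + by rewrite divr_ge0 ?ltW.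
    + move=> c i; have dA := BFNS_distr bfns (union_core ALG c).
      rewrite -[leLHS](expectation_cst _ dA); apply: expectation_le => // S _.
      by case: (best_value_ge f ALG c S) => _; apply.
    + move=> c; have dA := BFNS_distr bfns (union_core ALG c).
      apply: (le_trans (BFNS_value bfns (subsetIr _ _) _)).
        exact: leq_trans (subset_leq_card (subsetIl _ _)) OPT_card.
      by apply: expectation_le => // S _; case: (best_value_ge f ALG c S).
    + move=> c; have := sum_union_core f_ge0 f_submodular ALG_nice OPT c.
      by rewrite mulrA mulrBr mulr1 mul1r mulfV ?gt_eqF.
  split=> // beta1; apply: le_trans main; rewrite beta1.
  rewrite [(1 - _) * _ / e]mulrAC [leRHS]mulrAC.
  exact: ler_wpM2r num2.
Qed.
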